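(* Let $\mathbf{x}_1,\dots,\mathbf{x}_n\in\mathbb{R}^r$ be given points such that $\overline{D}\in\mathcal{S}^n$, $\overline{D}_{ij}=\|\mathbf{x}_i-\mathbf{x}_j\|_2^2$, has embedding dimension $r$. Let $Y=-\frac12 V^{\top}\overline{D}V$ be the projected Gram matrix of $\overline{D}$, let $U\in\mathbb{R}^{(n-1)\times(n-r-1)}$ be a matrix whose columns form an orthonormal basis of $\mathrm{null}(Y)$, and let $Z_1=VU\in\mathbb{R}^{n\times(n-r-1)}$. Let $v:=\mathrm{vec}(-Z_1Z_1^{\top})\in\mathbb{R}^{n(n+1)/2}$ and $H=\mathcal{P}^{*}(v)\in\mathcal{S}^{n+1}$. Let $$\Omega=\{D\in\mathcal{E}^{n+1}\mid D_{ij}=\|\mathbf{x}_i-\mathbf{x}_j\|_2^2,\ 1\le i,j\le n\}.$$ Then $H$ exposes $\mathrm{face}(\Omega,\mathcal{E}^{n+1})$.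
   Context: $\mathcal{S}^m$ is the space of real symmetric $m\times m$ matrices with the trace inner product $\langle A,B\rangle=\mathrm{trace}(AB)$. $\mathcal{E}^m\subseteq\mathcal{S}^m$ is the cone of Euclidean distance matrices: $D\in\mathcal{E}^m$ iff there exist a positive integer $d$ and points $p_1,\dots,p_m\in\mathbb{R}^d$ with $D_{ij}=\|p_i-p_j\|_2^2$ for all $i,j$. The embedding dimension of $\overline{D}$ is the dimension of the affine hull of $\mathbf{x}_1,\dots,\mathbf{x}_n$ (equivalently $\mathrm{rank}(Y)$ for the matrix $Y$ in the claim). The matrix $V\in\mathbb{R}^{n\times(n-1)}$ is $$V=\begin{bmatrix}-\frac{1}{\sqrt n}e_{n-1}^{\top}\\ I_{n-1}-\frac{1}{n+\sqrt n}e_{n-1}e_{n-1}^{\top}\end{bmatrix},$$ where $e_{n-1}$ is the all-ones vector in $\mathbb{R}^{n-1}$; it satisfies $V^{\top}e_n=0$, $V^{\top}V=I_{n-1}$, $VV^{\top}=I_n-\frac1n e_ne_n^{\top}$. $\mathrm{vec}:\mathcal{S}^n\to\mathbb{R}^{n(n+1)/2}$ maps a symmetric matrix to the vector of its upper triangular entries (diagonal included), indexed by pairs $(i,j)$ with $1\le i\le j\le n$. For $y\in\mathbb{R}^{n(n+1)/2}$ indexed in this way, $\mathcal{P}^{*}(y)\in\mathcal{S}^{n+1}$ is the symmetric matrix with $(\mathcal{P}^{*}(y))_{ij}=(\mathcal{P}^{*}(y))_{ji}=y_{ij}/2$ for $1\le i\le j\le n$, and all entries in row or column $n+1$ equal to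 $0$. (Thus $H$ is block diagonal with blocks $-Z_1Z_1^{\top}/2$ and $0$.) A convex subset $F$ of a convex set $C$ is a face of $C$ if whenever $x,y\in C$ and a point $z$ lying between $x$ and $y$ belongs to $F$, then $x,y\in F$. For $S\subseteq C$, $\mathrm{face}(S,C)$, the minimal face of $C$ containing $S$, is the intersection of all faces of $C$ containing $S$. For a convex cone $C$ in a Euclidean space $\mathbb{E}$, the dual cone is $C^*=\{x^*\in\mathbb{E}\mid\langle x,x^*\rangle\ge0\ \forall x\in C\}$, and a vector $w$ exposes a face $F$ of $C$ (is an exposing vector of $F$) if $w\in C^*$ and $F=C\cap w^{\perp}$, where $w^{\perp}=\{x\in\mathbb{E}\mid\langle w,x\rangle=0\}$. *)

(* Defs.v *)
From HB Require Import structures.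
From mathcomp Require Import all_boot all_order all_algebra.
From mathcomp Require Import boolp classical_sets reals convex.
Set Implicit Arguments.
Unset Strict Implicit.
Unset Printing Implicit Defensive.
Import Order.TTheory GRing.Theory Num.Theory.
Local Open Scope classical_set_scope.
Local Open Scope ring_scope.

(* Points of R^d are row vectors; the library norm on 'rV is the sup norm,
   hence an explicit Euclidean norm. *)
Definition norm2 (R : realType) (d : nat) (u : 'rV[R]_d) : R :=
  Num.sqrt (\sum_(k < d) u 0 k ^+ 2).

Definition sqdist_mx (R : realType) (m d : nat) (p : 'I_m -> 'rV[R]_d) :
    'M[R]_m :=
  \matrix_(i, j) norm2 (p i - p j) ^+ 2.

Definition Sym (R : realType) (m : nat) : set 'M[R]_m :=
  [set A | A \is symmetricmx].

Definition EDM (R : realType) (m : nat) : set 'M[R]_m :=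
  [set D | exists d (p : 'I_m -> 'rV[R]_d), (0 < d)%N /\ D = sqdist_mx p].

Definition affine_hull (R : realType) (n r : nat) (x : 'I_n -> 'rV[R]_r) :
    set 'rV[R]_r :=
  [set q | exists c : 'I_n -> R,
     \sum_i c i = 1 /\ q = \sum_i c i *: x i].

(* A is a translate of a d-dimensional linear subspace; never true of set0. *)
Definition has_affine_dim (R : realType) (r : nat) (A : set 'rV[R]_r)
    (d : nat) : Prop :=
  exists (q0 : 'rV[R]_r) (W : {vspace 'rV[R]_r}),
    \dim W = d /\ A = [set q | q - q0 \in W].

(* Row 0 is -e^T / sqrt n; row k.+1 is row k of I - e e^T / (n + sqrt n). *)
Definition Vmx (R : realType) (n : nat) : 'M[R]_(n, n.-1) :=
  \matrix_(i, j)
    if i == 0%N :> nat then - (Num.sqrt n%:R)^-1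
    else (i == j.+1 :> nat)%:R - (n%:R + Num.sqrt n%:R)^-1.

Definition proj_gram (R : realType) (n : nat) (D : 'M[R]_n) : 'M[R]_(n.-1) :=
  - 2^-1 *: ((Vmx R n)^T *m D *m Vmx R n).

Definition orthonormal_null_basis (R : realType) (m k : nat) (Y : 'M[R]_m)
    (U : 'M[R]_(m, k)) : Prop :=
  U^T *m U = 1%:M /\
  forall w : 'cV[R]_m, Y *m w = 0 <-> exists c : 'cV[R]_k, w = U *m c.

(* Index set of R^(n(n+1)/2): the positions of the upper triangle. *)
Definition upper_index (n : nat) : Type :=
  {p : 'I_n * 'I_n | (p.1 <= p.2)%N}.

Definition sort_pair (n : nat) (i j : 'I_n) : 'I_n * 'I_n :=
  if (i <= j)%N then (i, j) else (j, i).

Lemma sort_pairP (n : nat) (i j : 'I_n) :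
  ((sort_pair i j).1 <= (sort_pair i j).2)%N.
Proof. by rewrite /sort_pair; case: (leqP i j) => // /ltnW. Qed.

Definition upper_pair (n : nat) (i j : 'I_n) : upper_index n :=
  exist _ (sort_pair i j) (sort_pairP i j).

(* Meant for symmetric A, of which it keeps the upper triangle. *)
Definition vec (R : realType) (n : nat) (A : 'M[R]_n) : upper_index n -> R :=
  fun p => A (val p).1 (val p).2.

Definition Pstar (R : realType) (n : nat) (y : upper_index n -> R) :
    'M[R]_(n + 1) :=
  block_mx (\matrix_(i < n, j < n) (y (upper_pair i j) / 2)) 0 0 0.

Definition is_face (R : realType) (E : lmodType R) (C F : set E) : Prop :=
  [/\ convex_set F, F `<=` C
    & forall (a b : E) (t : R), C a -> C b -> 0 < t -> t < 1 ->
        F (t *: a + (1 - t) *: b) -> F a /\ F b].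

Definition min_face (R : realType) (E : lmodType R) (S C : set E) : set E :=
  \bigcap_(F in [set F | is_face C F /\ S `<=` F]) F.

Definition mx_inner (R : realType) (m : nat) (A B : 'M[R]_m) : R :=
  \tr (A *m B).

(* Dual cone and orthogonal complement are taken inside the Euclidean space
   Sym R m, not inside the space of all matrices. *)
Definition dual_cone (R : realType) (m : nat) (C : set 'M[R]_m) :
    set 'M[R]_m :=
  [set w | Sym w /\ forall A, C A -> 0 <= mx_inner A w].

Definition perp (R : realType) (m : nat) (w : 'M[R]_m) : set 'M[R]_m :=
  [set A | Sym A /\ mx_inner w A = 0].

Definition exposes (R : realType) (m : nat) (w : 'M[R]_m)
    (F C : set 'M[R]_m) : Prop :=
  [/\ is_face C F, dual_cone C w & F = C `&` perp w].

Definition Omega (R : realType) (n r : nat) (x : 'I_n -> 'rV[R]_r) :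
    set 'M[R]_(n + 1) :=
  [set D | EDM D /\
     forall i j : 'I_n, D (lshift 1 i) (lshift 1 j) = norm2 (x i - x j) ^+ 2].

(* Main.v *)
(* As V^T e = 0, pairing H with the distance matrix of points p_1, ..., p_{n+1}
   gives the squared Frobenius norm of P^T V U, where P has rows p_1, ..., p_n.
   So H is in the dual cone, and it vanishes on a distance matrix iff
   null(Y) is contained in null(P^T V), i.e. iff p_i = x_i A + b for i <= n.
   Let D0 in Omega be realised by the x_i and one affinely independent point;
   then p_1, ..., p_{n+1} is an affine image of that configuration, and
   Lagrange's identity makes c D0 - D a distance matrix for some c >= 0.
   Hence D lies in every face of the cone containing D0. *)

Require Import Defs.
From mathcomp Require Import all_boot all_order all_algebra.
From mathcomp Require Import boolp classical_sets reals convex.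
From mathcomp Require Import interval_inference ring lra.
Set Implicit Arguments.
Unset Strict Implicit.
Unset Printing Implicit Defensive.
Import Order.TTheory GRing.Theory Num.Theory.
Local Open Scope classical_set_scope.
Local Open Scope ring_scope.

Lemma norm2_sq (R : realType) (d : nat) (u : 'rV[R]_d) :
  norm2 u ^+ 2 = \sum_k u 0 k ^+ 2.
Proof. by rewrite sqr_sqrtr // sumr_ge0 // => k _; rewrite sqr_ge0. Qed.

(** The factor [2^-1] compensates for counting each unordered pair [{a, b}] twice. This writes the
    Cauchy-Schwarz defect as a sum of squares. *)
Lemma lagrange_identity (R : numFieldType) (n : nat) (z w : 'I_n -> R) :
  (\sum_i w i ^+ 2) * (\sum_i z i ^+ 2) - (\sum_i z i * w i) ^+ 2 =
  \sum_a \sum_b 2^-1 * (z a * w b - z b * w a) ^+ 2.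
Proof.
have e1 : \sum_a \sum_b z a ^+ 2 * w b ^+ 2 =
    (\sum_i w i ^+ 2) * (\sum_i z i ^+ 2).
  by rewrite mulrC big_distrlr.
have e2 : \sum_a \sum_b z b ^+ 2 * w a ^+ 2 =
    (\sum_i w i ^+ 2) * (\sum_i z i ^+ 2).
  by rewrite exchange_big.
have e3 : \sum_a \sum_b (z a * w a) * (z b * w b) = (\sum_i z i * w i) ^+ 2.
  by rewrite expr2 big_distrlr.
have -> : \sum_a \sum_b 2^-1 * (z a * w b - z b * w a) ^+ 2 =
    \sum_a \sum_b (2^-1 * (z a ^+ 2 * w b ^+ 2) +
      2^-1 * (z b ^+ 2 * w a ^+ 2) - (z a * w a) * (z b * w b)).
  by apply: eq_bigr => a _; apply: eq_bigr => b _; field.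
have -> : \sum_a \sum_b (2^-1 * (z a ^+ 2 * w b ^+ 2) +
      2^-1 * (z b ^+ 2 * w a ^+ 2) - (z a * w a) * (z b * w b)) =
    \sum_a (2^-1 * (\sum_b z a ^+ 2 * w b ^+ 2) +
      2^-1 * (\sum_b z b ^+ 2 * w a ^+ 2) - \sum_b (z a * w a) * (z b * w b)).
  by apply: eq_bigr => a _; rewrite sumrB big_split /= -!mulr_sumr.
rewrite sumrB big_split /= -!mulr_sumr.
by rewrite e1 e2 e3; field.
Qed.

(** * The convex cone of distance matrices and its faces *)

Section EDMCone.
Variable R : realType.

Lemma sqdist_EDM (m d : nat) (p : 'I_m -> 'rV[R]_d) :
  (0 < d)%N -> EDM (sqdist_mx p).
Proof. by move=> d0; exists d, p. Qed.

Lemma EDM_sym (m : nat) (D : 'M[R]_m) : EDM D -> Sym D.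
Proof.
move=> [d [p [_ ->]]]; rewrite /Sym /=; apply/is_hermitianmxP.
rewrite expr0 scale1r; apply/matrixP => i j; rewrite !mxE /= !norm2_sq.
by apply: eq_bigr => k _; rewrite !mxE; ring.
Qed.

Lemma EDM_add (m : nat) (A B : 'M[R]_m) : EDM A -> EDM B -> EDM (A + B).
Proof.
move=> [d [p [d0 ->]]] [e [q [_ ->]]].
exists (d + e)%N, (fun i => row_mx (p i) (q i)); split; first by rewrite addn_gt0 d0.
apply/matrixP => i j; rewrite !mxE !norm2_sq opp_row_mx add_row_mx big_split_ord.
by congr (_ + _); apply: eq_bigr => k _; rewrite ?row_mxEl ?row_mxEr.
Qed.

Lemma EDM_scale (m : nat) (c : R) (A : 'M[R]_m) :
  0 <= c -> EDM A -> EDM (c *: A).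
Proof.
move=> c0 [d [p [d0 ->]]]; exists d, (fun i => Num.sqrt c *: p i); split=> //.
apply/matrixP => i j; rewrite !mxE !norm2_sq mulr_sumr.
apply: eq_bigr => k _; rewrite -scalerBr [in RHS]mxE exprMn sqr_sqrtr //.
Qed.

Lemma EDM_rank1 (m : nat) (f : 'I_m -> R) :
  EDM (\matrix_(i, j) (f i - f j) ^+ 2).
Proof.
exists 1%N, (fun i => const_mx (f i)); split=> //.
by apply/matrixP => i j; rewrite !mxE norm2_sq big_ord1 !mxE.
Qed.

Lemma EDM0 (m : nat) : EDM (0 : 'M[R]_m).
Proof.
rewrite -(scale0r (\matrix_(i, j) ((0 : R) - 0) ^+ 2)).
exact/EDM_scale/(EDM_rank1 (fun=> 0)).
Qed.

Lemma EDM_sum (m : nat) (I : Type) (s : seq I) (F : I -> 'M[R]_m) :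
  (forall i, EDM (F i)) -> EDM (\sum_(i <- s) F i).
Proof. by move=> hF; apply: big_ind => //; [exact: EDM0|exact: EDM_add]. Qed.

(** Lagrange's identity is applied to [q i - q j] and each column of [M]. Every resulting square is
    linear in [q i - q j], hence of the form [(f i - f j) ^+ 2]: the squared distances of points on
    a line. The constant [c] is the squared Frobenius norm of [M]. *)
Lemma EDM_linear_image (m s d : nat) (q : 'I_m -> 'rV[R]_s) (M : 'M[R]_(s, d)) :
  exists2 c : R, 0 <= c &
    EDM (c *: sqdist_mx q - sqdist_mx (fun i => q i *m M)).
Proof.
exists (\sum_k \sum_b M b k ^+ 2).
  by apply: sumr_ge0 => k _; apply: sumr_ge0 => b _; apply: sqr_ge0.
have -> : (\sum_k \sum_b M b k ^+ 2) *: sqdist_mx q -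
    sqdist_mx (fun i => q i *m M) =
    \sum_k \sum_a \sum_b 2^-1 *: \matrix_(i, j)
      ((q i 0 a * M b k - q i 0 b * M a k)
       - (q j 0 a * M b k - q j 0 b * M a k)) ^+ 2.
  apply/matrixP => i j; rewrite !mxE summxE !norm2_sq mulr_suml -sumrB.
  apply: eq_bigr => k _.
  have -> : (q i *m M - q j *m M) 0 k = \sum_a (q i - q j) 0 a * M a k.
    by rewrite -mulmxBl mxE.
  rewrite lagrange_identity summxE; apply: eq_bigr => a _.
  by rewrite summxE; apply: eq_bigr => b _; rewrite !mxE; ring.
do 3![apply: EDM_sum => ?].
apply: EDM_scale; first by rewrite invr_ge0.
exact: (EDM_rank1 (fun i => q i 0 _ * M _ _ - q i 0 _ * M _ _)).
Qed.

Lemma mx_innerC (m : nat) (A B : 'M[R]_m) : mx_inner A B = mx_inner B A.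
Proof. exact: mxtrace_mulC. Qed.

Lemma mx_inner_lin (m : nat) (w A B : 'M[R]_m) (s t : R) :
  mx_inner w (s *: A + t *: B) = s * mx_inner w A + t * mx_inner w B.
Proof. by rewrite /mx_inner mulmxDr -!scalemxAr mxtraceD !mxtraceZ. Qed.

(** Two nonnegative numbers with zero sum vanish, so a convex combination orthogonal to [w] has both
    endpoints orthogonal to [w]. *)
Lemma exposed_is_face (m : nat) (w : 'M[R]_m) :
  dual_cone (@EDM R m) w -> is_face (@EDM R m) (@EDM R m `&` perp w).
Proof.
move=> [_ wge0]; split; last 1 first.
- move=> a b t Ea Eb t0 t1 [_ [_]]; rewrite mx_inner_lin => ab0.
  have := wge0 _ Ea; have := wge0 _ Eb; rewrite !(mx_innerC _ w) => b0 a0.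
  have ta : 0 <= t * mx_inner w a by apply: mulr_ge0 => //; apply: ltW.
  have tb : 0 <= (1 - t) * mx_inner w b.
    by apply: mulr_ge0 => //; rewrite subr_ge0 ltW.
  have a00 : t * mx_inner w a = 0 by lra.
  have b00 : (1 - t) * mx_inner w b = 0 by lra.
  split; split=> //; split; try exact: EDM_sym.
    by move/eqP: a00; rewrite mulf_eq0 gt_eqF //= => /eqP.
  by move/eqP: b00; rewrite mulf_eq0 subr_eq0 gt_eqF //= => /eqP.
- move=> a b l; rewrite !inE => -[Ea [_ a0]] [Eb [_ b0]].
  have Eab : EDM (l%:num *: a + (1 - l%:num) *: b).
    by apply: EDM_add; apply: EDM_scale => //; rewrite subr_ge0.
  split; first exact: Eab.
  split; first exact: EDM_sym Eab.
  by have := mx_inner_lin w a b l%:num (1 - l%:num); rewrite a0 b0 !mulr0 addr0.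
- by move=> a [].
Qed.

(* With [t = 1 / (c + 2)], [A] is a convex combination of [B] with weight [t]
   and of another EDM; [c + 2] rather than [c] ensures [0 < t < 1]. *)
Lemma face_dominated (m : nat) (F : set 'M[R]_m) (A B : 'M[R]_m) (c : R) :
  is_face (@EDM R m) F -> F A -> EDM B -> 0 <= c -> EDM (c *: A - B) -> F B.
Proof.
move=> [_ FE Fface] FA EB c0 ED.
have EA : EDM A by exact: FE.
have c2 : 0 < c + 2 by lra.
have c1 : 0 < c + 1 by lra.
set A' := (c + 1)^-1 *: ((c *: A - B) + 2 *: A).
have EA' : EDM A'.
  apply: EDM_scale; first by rewrite invr_ge0 ltW.
  by apply: EDM_add => //; apply: EDM_scale.
have t0 : 0 < (c + 2)^-1 by rewrite invr_gt0.
have t1 : (c + 2)^-1 < 1 by rewrite invf_lt1 //; lra.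
have tAB : (c + 2)^-1 *: B + (1 - (c + 2)^-1) *: A' = A.
  apply/matrixP => i j; rewrite !mxE; field.
  by rewrite !gt_eqF.
have [] // := Fface B A' (c + 2)^-1 EB EA' t0 t1.
by rewrite tAB.
Qed.

End EDMCone.

(** * Pairing with [H], and the left kernel of [V] *)

Section ProjectedGram.
Variable R : realType.

(** Expanding the squares gives [a *m e + (a *m e)^T - 2 *: (P *m P^T)]; the first two terms contain
    a factor [e], which [Z] annihilates. *)
Lemma sqdist_mx_congr (n d k : nat) (p : 'I_n -> 'rV[R]_d) (Z : 'M[R]_(n, k))
    (P := \matrix_i p i) :
  const_mx 1 *m Z = 0 :> 'rV_k ->
  Z^T *m sqdist_mx p *m Z = - 2 *: ((P^T *m Z)^T *m (P^T *m Z)).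
Proof.
move=> Z0; pose e : 'rV[R]_n := const_mx 1; pose a := \col_i norm2 (p i) ^+ 2.
have -> : sqdist_mx p = a *m e + (a *m e)^T - 2 *: (P *m P^T).
  apply/matrixP => i j; rewrite !mxE !big_ord1 !mxE !norm2_sq !mulr1.
  rewrite mulr_sumr -big_split -sumrB /=.
  by apply: eq_bigr => l _; rewrite !mxE; ring.
rewrite mulmxBr mulmxDr mulmxBl mulmxDl trmx_mul -!mulmxA Z0 !mulmx0 !mulmxA.
rewrite -trmx_mul Z0 trmx0 !mul0mx addr0 sub0r scaleNr; congr (- _).
by rewrite -scalemxAr -scalemxAl trmx_mul trmxK !mulmxA.
Qed.

Lemma mxtrace_gram_ge0 (m k : nat) (W : 'M[R]_(m, k)) : 0 <= \tr (W^T *m W).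
Proof.
by apply: sumr_ge0 => i _; rewrite mxE sumr_ge0 // => j _; rewrite mxE -expr2 sqr_ge0.
Qed.

Lemma mxtrace_gram_eq0 (m k : nat) (W : 'M[R]_(m, k)) :
  \tr (W^T *m W) = 0 -> W = 0.
Proof.
have W2 i j : 0 <= W^T j i * W i j by rewrite mxE -expr2 sqr_ge0.
have WW j : 0 <= (W^T *m W) j j by rewrite mxE sumr_ge0.
move=> /(psumr_eq0P (fun j _ => WW j)) tr0; apply/matrixP => i j.
have := tr0 j isT; rewrite !mxE => /(psumr_eq0P (fun i _ => W2 i j))/(_ i isT).
by rewrite mxE => /eqP; rewrite mulf_eq0 orbb => /eqP.
Qed.

Lemma mx_inner_Pstar (n k : nat) (D : 'M[R]_(n + 1)) (Z : 'M[R]_(n, k)) :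
  mx_inner D (Pstar (vec (- (Z *m Z^T)))) =
  - 2^-1 * \tr (Z^T *m ulsubmx D *m Z).
Proof.
(* [vec] reads only the upper triangle, so symmetry recovers the entries below the diagonal. *)
have ZZ_sym i j : (Z *m Z^T) i j = (Z *m Z^T) j i.
  by rewrite -[in LHS](trmxK (Z *m Z^T)) mxE trmx_mul trmxK.
have -> : Pstar (vec (- (Z *m Z^T))) = block_mx (- 2^-1 *: (Z *m Z^T)) 0 0 0.
  congr block_mx; apply/matrixP => i j; rewrite [LHS]mxE [RHS]mxE /vec /=.
  rewrite /sort_pair; case: ifP => _ /=; rewrite [(- _ : 'M__) _ _]mxE.
    by ring.
  by rewrite ZZ_sym; ring.
rewrite /mx_inner -{1}(submxK D) mulmx_block mxtrace_block !mulmx0 !addr0.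
by rewrite mxtrace0 addr0 -scalemxAr mxtraceZ mulmxA mxtrace_mulC mulmxA.
Qed.

Lemma mul_Vmx (n k : nat) (u : 'M[R]_(k, n.+1)) i j (s : R := Num.sqrt n.+1%:R) :
  (u *m Vmx R n.+1) i j = - (u i ord0 / s) + u i (lift ord0 j)
    - (n.+1%:R + s)^-1 * \sum_l u i (lift ord0 l).
Proof.
rewrite mxE big_ord_recl mxE eqxx mulrN -addrA; congr (_ + _).
rewrite mulr_sumr (bigD1 j) //= [in RHS](bigD1 j) //= !mxE /= /bump /= eqxx.
rewrite mulrBr mulr1 -addrA opprD mulrC; congr (_ + (_ + _)).
rewrite -sumrN; apply: eq_bigr => l lj; rewrite mxE /= /bump /= !add1n eqSS.
by rewrite (negbTE (_ : l != j :> nat)) // sub0r mulrN mulrC.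
Qed.

(** Eliminating [n] in favour of [s] turns the denominator of [V] into [s * (s + 1)], and the
    identities below become rational in [s] alone. *)
Lemma sqrt_natS (n : nat) (s : R := Num.sqrt n.+1%:R) :
  0 < s /\ n%:R = s ^+ 2 - 1.
Proof.
split; first by rewrite sqrtr_gt0 ltr0n.
by rewrite sqr_sqrtr ?ler0n // -natr1 addrK.
Qed.

Lemma ones_Vmx (n : nat) : const_mx 1 *m Vmx R n = 0 :> 'rV_(n.-1).
Proof.
case: n => [|n]; first by apply/matrixP => i [].
have [s0 ns] := sqrt_natS n; set s := Num.sqrt _ in s0 ns.
apply/matrixP => i j; rewrite mul_Vmx !mxE.
under eq_bigr do rewrite mxE.
rewrite sumr_const card_ord -/s -natr1 ns; field.
have -> : s ^+ 2 - 1 + 1 + s = s * (s + 1) by ring.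
by rewrite mulf_neq0 ?gt_eqF //; lra.
Qed.

(** The equation of column [l] gives [Q i (lift ord0 l)] a value independent of [l], in terms of
    [Q i ord0] and the sum [S]. Summing over [l] determines [S], and substituting back gives
    [Q i ord0]. *)
Lemma Vmx_left_kernel (n d : nat) (Q : 'M[R]_(d, n.+1)) :
  Q *m Vmx R n.+1 = 0 -> forall i j, Q i j = Q i ord0.
Proof.
have [s0 ns] := sqrt_natS n; set s := Num.sqrt _ in s0 ns.
move=> Q0 i j; pose S := \sum_l Q i (lift ord0 l).
have ss1 : s * (s + 1) != 0 by rewrite mulf_neq0 ?gt_eqF //; lra.
pose c : R := (s * (s + 1))^-1.
have Ql l : Q i (lift ord0 l) = Q i ord0 / s + c * S.
  have := mul_Vmx Q i l; rewrite Q0 mxE -/s -/S /=.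
  have -> : n.+1%:R + s = s * (s + 1) by rewrite -natr1 ns; ring.
  by rewrite -/c; lra.
have SE : S = n%:R * (Q i ord0 / s + c * S).
  by rewrite {1}/S (eq_bigr _ (fun l _ => Ql l)) sumr_const card_ord mulr_natl.
have {}SE : S = n%:R * Q i ord0.
  have sne : s != 0 by rewrite gt_eqF.
  have s1 : s + 1 != 0 by rewrite gt_eqF //; lra.
  (* Here [n%:R * c = (s - 1) / s], so collecting the terms in [S] leaves the coefficient
     [1 / s]. *)
  have : S / s = (s ^+ 2 - 1) * Q i ord0 / s.
    have : S - n%:R * (Q i ord0 / s + c * S) = 0 by rewrite -SE subrr.
    rewrite ns /c => h; apply/eqP; rewrite -subr_eq0; apply/eqP.
    by rewrite -[RHS]h; field; rewrite sne s1.
  by rewrite ns => /(mulIf (invr_neq0 sne)).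
case: (unliftP ord0 j) => [l ->|-> //]; rewrite Ql SE ns /c; field.
by rewrite !gt_eqF //; lra.
Qed.

End ProjectedGram.

(** * Affine images of the given points and domination in the cone *)

Section AffineImage.
Variable R : realType.

(** As [Y] is the Gram matrix of [X^T *m V], the cokernel of the latter lies in null([Y]), the
    column span of [U], which [P^T *m V] kills. Hence [P^T *m V] factors through [X^T *m V]. *)
Lemma affine_image_of_null (n r d k : nat) (x : 'I_n -> 'rV[R]_r)
    (p : 'I_n -> 'rV[R]_d) (U : 'M[R]_(n.-1, k)) :
  orthonormal_null_basis (proj_gram (sqdist_mx x)) U ->
  (\matrix_i p i)^T *m (Vmx R n *m U) = 0 ->
  exists A b, forall i, p i = x i *m A + b.
Proof.
case: n => [|n] in x p U *; first by exists 0, 0 => -[].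
set X := \matrix_i x i; set P := \matrix_i p i; set V := Vmx R n.+1.
move=> [_ nullY] PVU.
have : (P^T *m V <= X^T *m V)%MS.
  rewrite submxE; apply/eqP/matrixP => i j.
  have Yw : proj_gram (sqdist_mx x) *m col j (cokermx (X^T *m V)) = 0.
    rewrite /proj_gram sqdist_mx_congr ?ones_Vmx // -!scalemxAl -mulmxA colE.
    by rewrite [X in _ *m X]mulmxA mulmx_coker mul0mx mulmx0 !scaler0.
  have [c jc] := (nullY _).1 Yw.
  have : col j (P^T *m V *m cokermx (X^T *m V)) = 0.
    by rewrite colE -mulmxA -colE jc mulmxA -(mulmxA P^T) PVU mul0mx.
  by move/matrixP/(_ i ord0); rewrite mxE => ->; rewrite !mxE.
move=> /submxP[B PB].
(* The rows of [P^T - B *m X^T] are therefore constant; their common values are the coordinates of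
   the translation [b]. *)
have /Vmx_left_kernel Q0 : (P^T - B *m X^T) *m V = 0.
  by rewrite mulmxBl PB mulmxA subrr.
exists B^T, (\row_j (P^T - B *m X^T) j ord0) => i; apply/rowP => j.
rewrite [RHS]mxE [X in _ + X]mxE -(Q0 j i).
have -> : (x i *m B^T) 0 j = (B *m X^T) j i.
  by rewrite -[B *m X^T]trmxK trmx_mul trmxK [RHS]mxE -[x i](rowK x) -row_mul mxE.
have := congr1 (fun M : 'M[R]__ => M j i) (subrKC (B *m X^T) P^T).
by rewrite mxE => ->; rewrite !mxE.
Qed.

(* The new point is affinely independent of the given ones, so every
   configuration whose first [n] points are an affine image of [x] is an affine
   image of this one. *)
Definition lift_points (n r : nat) (x : 'I_n -> 'rV[R]_r) (i : 'I_(n + 1)) :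
    'rV[R]_(r + 1) :=
  match split i with inl j => row_mx (x j) 0 | inr _ => row_mx 0 1%:M end.

Lemma Omega_lift_points (n r : nat) (x : 'I_n -> 'rV[R]_r) :
  Omega x (sqdist_mx (lift_points x)).
Proof.
split; first by apply: sqdist_EDM; rewrite addn1.
move=> i j; rewrite mxE /lift_points !(unsplitK (inl _)) !norm2_sq.
rewrite opp_row_mx add_row_mx subrr big_split_ord big_ord1 row_mxEr.
rewrite [(0 : 'M__) _ _]mxE expr0n /= addr0.
by apply: eq_bigr => k _; rewrite row_mxEl.
Qed.

Lemma EDM_dominated (n r d : nat) (x : 'I_n -> 'rV[R]_r)
    (p : 'I_(n + 1) -> 'rV[R]_d) (A : 'M[R]_(r, d)) (b : 'rV[R]_d) :
  (forall i, p (lshift 1 i) = x i *m A + b) ->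
  exists2 c : R, 0 <= c & EDM (c *: sqdist_mx (lift_points x) - sqdist_mx p).
Proof.
(* The last row is chosen so that the extra point of [lift_points] is sent to the last point of [p]
   after translation by [b]. *)
move=> pA; pose M := col_mx A (p (rshift n ord0) - b).
have pM i : p i = lift_points x i *m M + b.
  rewrite /lift_points; case: split_ordP => j ->; rewrite mul_row_col mul0mx.
    by rewrite addr0.
  by rewrite ord1 mul1mx add0r subrK.
have -> : sqdist_mx p = sqdist_mx (fun i => lift_points x i *m M).
  by apply/matrixP => i j; rewrite !mxE !pM opprD addrACA subrr addr0.
exact: EDM_linear_image.
Qed.

End AffineImage.

Theorem theorem2p11 (R : realType) (n r : nat) (x : 'I_n -> 'rV[R]_r)
    (U : 'M[R]_(n.-1, n - r - 1)) :
  let Dbar := sqdist_mx x in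
  let Y := proj_gram Dbar in
  let Z1 := Vmx R n *m U in
  let v := vec (- (Z1 *m Z1^T)) in
  let H := Pstar v in
  has_affine_dim (affine_hull x) r ->
  orthonormal_null_basis Y U ->
  exposes H (min_face (Omega x) (@EDM R (n + 1))) (@EDM R (n + 1)).
Proof.
move=> Dbar Y Z1 v H _ YU.
have Z10 : const_mx 1 *m Z1 = 0 :> 'rV_(n - r - 1).
  by rewrite mulmxA ones_Vmx mul0mx.
have innerH d (p : 'I_(n + 1) -> 'rV[R]_d)
    (W := (\matrix_i p (lshift 1 i))^T *m Z1) :
    mx_inner (sqdist_mx p) H = \tr (W^T *m W).
  rewrite mx_inner_Pstar.
  have -> : ulsubmx (sqdist_mx p) = sqdist_mx (p \o lshift 1).
    by apply/matrixP => i j; rewrite !mxE.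
  by rewrite sqdist_mx_congr // mxtraceZ mulrA mulrNN mulVf ?mul1r ?pnatr_eq0.
have symH : Sym H.
  apply/is_hermitianmxP; rewrite expr0 scale1r map_mx_id // tr_block_mx !trmx0.
  congr block_mx; apply/matrixP => i j; rewrite !mxE; congr (v _ / 2).
  (* [sort_pair] is symmetric in its arguments; on the diagonal both orders coincide. *)
  apply: val_inj => /=; rewrite /sort_pair.
  by case: ltngtP => // /val_inj ->.
have dualH : dual_cone (@EDM R (n + 1)) H.
  split=> // _ [d [p [_ ->]]]; rewrite innerH; exact: mxtrace_gram_ge0.
have faceH := exposed_is_face dualH.
have YU0 : Y *m U = 0.
  apply/matrixP => i j.
  have : Y *m (U *m delta_mx j 0 : 'cV_ _) = 0 by apply/YU.2; eexists.
  by rewrite mulmxA -colE => /matrixP/(_ i 0); rewrite !mxE.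
have OmegaH : Omega x `<=` @EDM R (n + 1) `&` perp H.
  move=> D [ED Dx]; split=> //; split; first exact: EDM_sym.
  rewrite mx_innerC mx_inner_Pstar.
  have -> : ulsubmx D = Dbar by apply/matrixP => i j; rewrite !mxE Dx.
  (* Absorbing [- 2^-1] into the product makes [Y] appear: the pairing is the trace of
     [U^T *m Y *m U]. *)
  rewrite -mxtraceZ trmx_mul.
  have -> : - 2^-1 *: (U^T *m (Vmx R n)^T *m Dbar *m (Vmx R n *m U)) =
      U^T *m (Y *m U).
    by rewrite /Y /proj_gram -!scalemxAl -scalemxAr !mulmxA.
  by rewrite YU0 mulmx0 mxtrace0.
have minE : min_face (Omega x) (@EDM R (n + 1)) = @EDM R (n + 1) `&` perp H.
  (* One inclusion is immediate, the exposed set being itself a face that contains [Omega x]. *)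
  apply/seteqP; split=> D; first by apply; split.
  move=> [[d [p [d0 ->]]] [_]]; rewrite mx_innerC innerH => /mxtrace_gram_eq0 PZ.
  move=> F [faceF OmegaF].
  have [A [b pA]] := affine_image_of_null YU PZ.
  have [c c0 Ec] := EDM_dominated pA.
  have /OmegaF FA := Omega_lift_points x.
  exact: face_dominated faceF FA (sqdist_EDM p d0) c0 Ec.
by rewrite minE.
Qed.
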